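(* Let $X$ be a Urysohn space with an H-closed $\pi$-base. Then $|X|\leq 2^{wL(X)\,k(X)}$.
   Context: All spaces are Hausdorff topological spaces. A space is Urysohn if any two distinct points have open neighborhoods with disjoint closures. A $\pi$-base of $X$ is a family $\mathcal{B}$ of non-empty open subsets of $X$ such that every non-empty open subset of $X$ contains a member of $\mathcal{B}$. A space $Y$ is H-closed if it is Hausdorff and closed in every Hausdorff space in which it is embedded; equivalently, $Y$ is Hausdorff and every open cover $\mathcal{U}$ of $Y$ has a finite subfamily $\mathcal{V}\subseteq\mathcal{U}$ with $\overline{\bigcup\mathcal{V}}=Y$. An H-closed $\pi$-base of $X$ is a $\pi$-base $\mathcal{B}$ of $X$ such that $\overline{B}$ (with the subspace topology) is H-closed for every $B\in\mathcal{B}$. The weak Lindelöf number $wL(X)$ is the least cardinal $\kappa$ such that every open cover $\mathcal{U}$ of $X$ has a subfamily $\mathcal{V}\subseteq\mathcal{U}$ with $|\mathcal{V}|\leq\kappa$ and $\overline{\bigcup\mathcal{V}}=X$. The cardinal $k(X)$ (Alas–Kocinac) is the least cardinal $\kappa$ such that for every $x\in X$ there is a family $\mathcal{V}_x$ of open neighborhoods of $x$ with $|\mathcal{V}_x|\leq\kappa$ such that for every open neighborhood $U$ of $x$ there is $V\in\mathcal{V}_x$ with $\overline{V}\subseteq\overline{U}$. *)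

(* Defs.v *)
From mathcomp Require Import all_boot.
From mathcomp Require Import all_classical topology.

Set Implicit Arguments.
Unset Strict Implicit.
Unset Printing Implicit Defensive.

Local Open Scope classical_set_scope.
Local Open Scope card_scope.

(* Cardinals are represented by sets compared with [#<=].  A cardinal function
   defined as "the least cardinal such that ..." is a set of least cardinality
   satisfying the condition, chosen among the subsets of a type large enough to
   contain one; see [wLP], [wL_min], [kP] and [k_min]. *)

Lemma inj_least (I : Type) (T : I -> Type) : inhabited I ->
  exists i, forall j, exists f : T i -> T j, injective f.
Proof.
move=> [i0].
pose P := [set S : set (forall i, T i) |
  forall x y, S x -> S y -> forall i, x i = y i -> x = y].
have [F FP Ftot|A [PA Amax]] := @Zorn_bigcup _ P.
  move=> x y [X FX Xx] [Y FY Yy] i xy.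
  have [XY|YX] := Ftot _ _ FX FY.
    exact: (FP _ FY _ _ (XY _ Xx) Yy i).
  exact: (FP _ FX _ _ Xx (YX _ Yy) i).
have [[i Ai]|nA] := pselect (exists i, forall t, exists2 x, A x & x i = t).
  exists i => j; pose g t := s2val (cid2 (Ai t)).
  have Ag t : A (g t) by rewrite /g; case: cid2.
  have gi t : g t i = t by rewrite /g; case: cid2.
  exists (fun t => g t j) => s t /(PA _ _ (Ag s) (Ag t)) st.
  by rewrite -(gi s) -(gi t) st.
have {}nA i : exists t, forall x, A x -> x i <> t.
  apply: contrapT => nt; apply: nA; exists i => t.
  apply: contrapT => nx; apply: nt; exists t => x Ax xt.
  by apply: nx; exists x.
pose y i := projT1 (cid (nA i)).
have yA i x : A x -> x i <> y i by rewrite /y; case: cid => //= t; apply.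
exfalso; apply: (Amax (A `|` [set y])).
  split; first by left.
  by move=> /(_ y (or_intror erefl)) Ay; exact: (yA i0 _ Ay).
move=> u v [Au|->] [Av|->] i uv //.
- exact: (PA _ _ Au Av i).
- by case: (yA i _ Au).
- by case: (yA i _ Av).
Qed.

Lemma card_le_inj (T U : Type) (A : set T) (B : set U) (f : A -> B) :
  injective f -> A #<= B.
Proof.
move=> finj; apply/card_leP; apply/injfunPex.
by exists f => // x y _ _; exact: finj.
Qed.

Lemma card_le_total (T U : Type) (A : set T) (B : set U) :
  A #<= B \/ B #<= A.
Proof.
have [[] H] := @inj_least bool (fun b => if b then A : Type else B : Type)
  (inhabits true).
  by left; have [f /card_le_inj] := H false.
by right; have [f /card_le_inj] := H true.
Qed.

Section LeastCard.
Variables (T : Type) (P : set (set T)).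

Definition least_card : set T :=
  xget set0 [set K | P K /\ forall L, P L -> K #<= L].

Lemma least_cardP : P !=set0 ->
  P least_card /\ forall L, P L -> least_card #<= L.
Proof.
move=> [K0 PK0].
suff : exists K, P K /\ forall L, P L -> K #<= L by exact: xgetPex.
have [[K PK] KP] := @inj_least {K | P K} (fun K => sval K : Type)
  (inhabits (exist _ K0 PK0)).
exists K; split=> // L PL.
by have [f /card_le_inj] := KP (exist _ L PL).
Qed.

End LeastCard.

Section Space.
Variable X : topologicalType.

Definition Urysohn_space := forall x y : X, x <> y ->
  exists U V, [/\ open_nbhs x U, open_nbhs y V &
                  closure U `&` closure V = set0].

Definition pi_base (B : set (set X)) :=
  (forall b, B b -> open b /\ b !=set0) /\
  (forall U, open U -> U !=set0 -> exists2 b, B b & b `<=` U).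

Definition embedding (Z : topologicalType) (f : X -> Z) :=
  injective f /\ (@open X = [set f @^-1` V | V in @open Z]).

Definition H_closed := hausdorff_space X /\
  forall (Z : topologicalType) (f : X -> Z),
    hausdorff_space Z -> embedding f -> closed (range f).

Definition open_cover (C : set (set X)) :=
  C `<=` open /\ \bigcup_(U in C) U = setT.

(* wL(X) <= |K| *)
Definition wL_le (T : Type) (K : set T) := forall C, open_cover C ->
  exists D, [/\ D `<=` C, D #<= K & closure (\bigcup_(U in D) U) = setT].

(* k(X) <= |K| *)
Definition k_le (T : Type) (K : set T) := forall x : X,
  exists V, [/\ V `<=` open_nbhs x, V #<= K &
    forall U, open_nbhs x U -> exists2 W, V W & closure W `<=` closure U].

Definition wL : set (set X) := least_card (@wL_le (set X)).

Definition k : set (set X) := least_card (@k_le (set X)).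

End Space.

Arguments wL_le X {T} K.
Arguments k_le X {T} K.
Arguments wL : clear implicits.
Arguments k : clear implicits.

Definition H_closed_pi_base (X : topologicalType) (B : set (set X)) :=
  pi_base B /\ forall b, B b -> H_closed (set_type (closure b)).

Section LeastCardSpec.
Variable X : topologicalType.

Let least_transfer (Q : forall T, set T -> Prop) :
  (forall T U (A : set T) (B : set U), A #<= B -> Q T A -> Q U B) ->
  Q (set X) setT ->
  Q (set X) (least_card (Q (set X))) /\
  forall T (K : set T), Q T K -> least_card (Q (set X)) #<= K.
Proof.
move=> Qmono QT.
have [Ql lmin] := @least_cardP (set X) (Q (set X)) (ex_intro _ setT QT).
split=> // T K QK.
have [KT|] := card_le_total K [set: set X]; last first.
  by apply: card_le_trans; exact: card_leT.
have [f _ finj] : exists2 f : T -> set X, set_fun K setT f & set_inj K f.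
  by apply/injfunPex; exact/pcard_leP.
have := inj_card_eq finj; rewrite card_eq_le => /andP[fK Kf].
exact: card_le_trans (lmin _ (Qmono _ _ _ _ Kf QK)) fK.
Qed.

Let wL_spec : wL_le X (wL X) /\
  forall T (K : set T), wL_le X K -> wL X #<= K.
Proof.
apply: (@least_transfer (@wL_le X)) => [T U A B AB QA C /QA[D [DC DA Dd]]|C].
  by exists D; split=> //; exact: card_le_trans DA AB.
move=> [_ CT]; exists C; split=> //; first exact: card_leT.
by rewrite CT closureT.
Qed.

Lemma wLP : wL_le X (wL X). Proof. exact: wL_spec.1. Qed.

Lemma wL_min (T : Type) (K : set T) : wL_le X K -> wL X #<= K.
Proof. exact: wL_spec.2. Qed.

Let k_spec : k_le X (k X) /\
  forall T (K : set T), k_le X K -> k X #<= K.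
Proof.
apply: (@least_transfer (@k_le X)) => [T U A B AB QA x|x].
  have [V [Vx VA Vb]] := QA x.
  by exists V; split=> //; exact: card_le_trans VA AB.
exists (open_nbhs x); split=> //; first exact: card_leT.
by move=> U Ux; exists U.
Qed.

Lemma kP : k_le X (k X). Proof. exact: k_spec.1. Qed.

Lemma k_min (T : Type) (K : set T) : k_le X K -> k X #<= K.
Proof. exact: k_spec.2. Qed.

End LeastCardSpec.

(* Main.v *)
From HB Require Import structures.
Require Import Defs.
From mathcomp Require Import all_boot.
From mathcomp Require Import all_classical topology.

(** Let [K] be the set [wL X `*` k X].  When [k X] is finite, a Urysohn space
    is discrete ([finite_k_discrete]); the cover by singletons then has no
    proper dense subfamily, so that [X] has at most [wL X] points
    ([discrete_wL]).  Otherwise [K] is infinite and it remains to show that [X]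
    is the image of the powerset of [K], which is called being small below.

    Fix neighbourhoods [V x i], [i] in [K], such that every neighbourhood of [x]
    has a closure containing that of some [V x i].  The proof is a closing-off
    argument.  A point [p] in the theta-closure of a set is determined by points
    [s i] of that set in the closure of [V p i], together with the pairs [(i, j)]
    for which [s j] lies in the closure of [V p i]: this is where the Urysohn
    property enters ([theta_trace_inj]).  So a small set is contained in a small
    theta-closed set, which can moreover be closed under any small family of
    [K]-ary operations ([theta_closing_off]).

    This is used twice.  First, an H-closed subspace [Y] is small
    ([H_closed_small]).  Take [A] closed under choosing a point of [Y] outside a
    [K]-indexed union of closures of neighbourhoods [V (s i) (t i)] with [s i] in
    [A].  If [q] in [Y] were not in [A], cover the points of [A] by
    neighbourhoods whose closures miss [q] and the others by neighbourhoods
    whose closures miss [A]; a finite subfamily has closures covering [Y], and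
    the point chosen outside its members centred in [A] would be covered by
    none of them.

    Secondly, the whole space is small ([small_space]).  Let [A] contain, for
    every [K]-indexed union of sets [V (s i) (t i)] with [s i] in [A] that misses
    some member of the pi-base, the closure of such a member, which is small by
    the first step.  If [A] were not everything, some member [b0] of the pi-base
    would have closure disjoint from [A]; by H-closedness every point of [A] has
    a neighbourhood [V a i] missing [b0] ([H_closed_sep]).  These sets and the
    complement of [A] cover [X], and a dense subfamily indexed by [K] gives a
    member [b] of the pi-base that lies in [A] and misses the chosen [V a i],
    hence misses the union of the subfamily: a contradiction.

    The closing-off itself does not iterate along ordinals: the closure of a
    point under [K]-ary operations is the set of values of well-founded
    [K]-branching trees, and such trees are coded by subsets of [K]
    ([small_tree]) since [K * K] injects into the infinite set [K]
    ([square_nat_injects]). *)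

Set Implicit Arguments.
Unset Strict Implicit.
Unset Printing Implicit Defensive.

Local Open Scope classical_set_scope.
Local Open Scope card_scope.

(** * Infinite sets absorb their squares *)

Definition injects (T U : Type) := exists f : T -> U, injective f.

Lemma injects_trans T U W : injects T U -> injects U W -> injects T W.
Proof. by move=> [f fi] [g gi]; exists (g \o f); exact: inj_comp. Qed.

Lemma card_le_fun (T U : Type) (A : set T) (B : set U) : inhabited U ->
  A #<= B -> exists2 f : T -> U, (forall x, A x -> B (f x)) &
    forall x y, A x -> A y -> f x = f y -> x = y.
Proof.
move=> [u0] /card_leP/injfunPex[g _ ginj].
pose f x := if pselect (A x) is left Ax then val (g (SigSub (mem_set Ax))) else u0.
exists f => [x|x y] Ax; rewrite /f; case: pselect => // Ax'.
  exact/set_mem/valP.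
move=> Ay; case: pselect => // Ay' /val_inj/ginj => /(_ _ _)/(congr1 val).
by apply; rewrite inE.
Qed.

Section Square.
Variable K : choiceType.
Implicit Types (A : set K) (f : K -> K -> nat -> K).

(** Carrying the factor [nat] along makes the extension of a pairing from [A] to
    twice [A] uniform: the finitely many quadrants are stored in that factor. It
    also rules out nonempty finite [A]. *)
Definition pairing_on A f :=
  (forall x y n, A x -> A y -> A (f x y n)) /\
  forall x y n x' y' n', A x -> A y -> A x' -> A y' ->
    f x y n = f x' y' n' -> [/\ x = x', y = y' & n = n'].

Definition pairing_graph A f : set (K * K * nat * K) :=
  [set t | let: (x, y, n, z) := t in [/\ A x, A y & z = f x y n]].

(** With [h] a copy of [A] inside its complement, the values of the new pairing
    on the three new quadrants of the square of [A `|` h @` A] are put in the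
    copy, and those on [A] itself are kept.  The empty pairing is extended to a
    countable set instead. *)
Lemma pairing_extend A f : injects nat K -> pairing_on A f -> A #<= ~` A ->
  exists B g, pairing_on B g /\ pairing_graph A f `<` pairing_graph B g.
Proof.
move=> [c cinj] [fA finj] /card_le_fun-/(_ (inhabits (c 0)))[h hA hinj].
have [->|/set0P[a Aa]] := eqVneq A set0; last first.
  (* the point of [A] below [x], and whether [x] lies in the copy *)
  pose p x := if pselect (A x) then (x, false)
    else (xget (c 0) [set y | A y /\ h y = x], true).
  pose B := A `|` h @` A.
  have pB x : B x -> A (p x).1 /\ (if (p x).2 then h (p x).1 else (p x).1) = x.
    rewrite /p; case: pselect => //= nAx [//|[y Ay yx]].
    have : exists y, A y /\ h y = x by exists y.
    by move=> /xgetPex-/(_ (c 0))[].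
  have pA x : A x -> p x = (x, false) by rewrite /p; case: pselect.
  pose g x y n := if (p x).2 || (p y).2 then
      h (f (p x).1 (p y).1 (pickle ((p x).2, (p y).2, n)))
    else f (p x).1 (p y).1 n.
  have gA x y n : A x -> A y -> g x y n = f x y n.
    by move=> Ax Ay; rewrite /g !pA.
  exists B, g; split; first split.
  - move=> x y n /pB[px _] /pB[py _]; rewrite /g; case: ifP => _.
      by right; exists (f (p x).1 (p y).1 (pickle ((p x).2, (p y).2, n))) => //;
        exact: fA.
    by left; exact: fA.
  - move=> x y n x' y' n' /pB[px xE] /pB[py yE] /pB[px' xE'] /pB[py' yE'].
    have hn u u' : A u -> A u' -> h u <> u'.
      by move=> Au Au' uu'; apply: (hA _ Au); rewrite uu'.
    rewrite /g; case: ifP => E; case: ifP => E' H.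
    + move/hinj: H => /(_ (fA _ _ _ px py) (fA _ _ _ px' py')).
      move=> /(finj _ _ _ _ _ _ px py px' py')[e1 e2 e3].
      have /(pcan_inj pickleK) := e3; case=> b1 b2 b3.
      by rewrite -xE -yE -xE' -yE' e1 e2 b1 b2.
    + by case: (hn _ _ (fA _ _ _ px py) (fA _ _ _ px' py') H).
    + by case: (hn _ _ (fA _ _ _ px' py') (fA _ _ _ px py) (esym H)).
    + move: H => /(finj _ _ _ _ _ _ px py px' py')[e1 e2 e3].
      move: E E' => /norP[/negPf b1 /negPf b2] /norP[/negPf b1' /negPf b2'].
      by rewrite -xE -yE -xE' -yE' e1 e2 b1 b2 b1' b2'.
  - split=> [[[[x y] n] z] [Ax Ay ->]|]; first by split; [left|left|rewrite gA].
    have Bha : B (h a) by right; exists a.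
    move=> /(_ (h a, h a, 0, g (h a) (h a) 0))[]; first by split.
    by move=> /(hA _ Aa).
pose d x := xget 0 [set n | c n = x].
have cK n : d (c n) = n.
  have : exists m, c m = c n by exists n.
  by move=> /xgetPex-/(_ 0) /cinj.
exists (range c), (fun x y n => c (pickle (d x, d y, n))); split; first split.
- by move=> x y n _ _; exists (pickle (d x, d y, n)).
- move=> x y n x' y' n' [i _ <-] [j _ <-] [i' _ <-] [j' _ <-] /cinj.
  by rewrite !cK => /(pcan_inj pickleK)[-> -> ->].
- split=> [[[[x y] n] z] []//|].
  by move=> /(_ (c 0, c 0, 0, c (pickle (d (c 0), d (c 0), 0))))[].
Qed.

(** Zorn's lemma gives a pairing on some [A] that cannot be extended, so that
    the complement of [A] injects into [A]; then [K] injects into two copies of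
    [A], and the pairing on [A] absorbs them. *)
Lemma square_nat_injects : injects nat K -> injects (K * K * nat) K.
Proof.
move=> Kinf; have [c cinj] := Kinf.
pose P := [set G | exists A f, pairing_on A f /\ G = pairing_graph A f].
have [F FP Ftot|G [[A [f [[fA finj] GE]]] Gmax]] := @Zorn_bigcup _ P.
  pose G := \bigcup_(H in F) H.
  pose A := [set x | exists z, G (x, x, 0, z)].
  pose f x y n := xget (c 0) [set z | G (x, y, n, z)].
  (* any two elements of the union belong to one member of the chain *)
  have dir H H' : F H -> F H' -> exists B g, [/\ pairing_on B g,
      F (pairing_graph B g), H `<=` pairing_graph B g
      & H' `<=` pairing_graph B g].
    move=> FH FH'.
    have [B [g [Bg HE]]] := FP _ FH; have [B' [g' [Bg' HE']]] := FP _ FH'.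
    have [HH|HH] := Ftot _ _ FH FH'.
      by exists B', g'; rewrite -HE'; split.
    by exists B, g; rewrite -HE; split.
  have Gf x y n z : G (x, y, n, z) -> f x y n = z.
    move=> Gz; have : exists z, G (x, y, n, z) by exists z.
    move=> /xgetPex-/(_ (c 0)); rewrite -/(f x y n) => -[H FH Hf].
    case: Gz => H' FH' Hz.
    have [B [g [_ _ HB HB']]] := dir _ _ FH FH'.
    by move: (HB _ Hf) (HB' _ Hz) => [_ _ ->] [_ _ ->].
  have AG x y : A x -> A y -> exists B g, [/\ pairing_on B g, B x, B y &
      forall u v n, B u -> B v -> G (u, v, n, g u v n)].
    move=> [z [H FH Hz]] [z' [H' FH' Hz']].
    have [B [g [Bg FB HB HB']]] := dir _ _ FH FH'.
    exists B, g; split=> //.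
    - by have [] := HB _ Hz.
    - by have [] := HB' _ Hz'.
    - by move=> u v n Bu Bv; exists (pairing_graph B g).
  have Gfld x y n z : G (x, y, n, z) -> [/\ A x, A y & A z].
    move=> [H FH Hz]; have [B [g [[gB _] HE]]] := FP _ FH.
    have BA u : B u -> A u.
      by move=> Bu; exists (g u u 0), H => //; rewrite HE; split.
    move: Hz; rewrite HE => -[Bx By ->].
    by split; apply: BA => //; exact: gB.
  exists A, f; split; first split.
  - move=> x y n Ax Ay; have [B [g [_ Bx By BG]]] := AG _ _ Ax Ay.
    have gG := BG x y n Bx By.
    by rewrite (Gf _ _ _ _ gG); have [] := Gfld _ _ _ _ gG.
  - move=> x y n x' y' n' Ax Ay Ax' Ay'.
    have [B [g [_ Bx By BG]]] := AG _ _ Ax Ay.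
    have [B' [g' [_ Bx' By' BG']]] := AG _ _ Ax' Ay'.
    have gG := BG x y n Bx By; have gG' := BG' x' y' n' Bx' By'.
    rewrite (Gf _ _ _ _ gG) (Gf _ _ _ _ gG') => gg.
    case: gG => H FH Hg; case: gG' => H' FH' Hg'.
    have [C [k [[_ kinj] _ HC HC']]] := dir _ _ FH FH'.
    move: (HC _ Hg) (HC' _ Hg') => [Cx Cy gk] [Cx' Cy' gk'].
    by apply: kinj => //; rewrite -gk -gk'.
  - apply/seteqP; split=> [[[[x y] n] z] Gz|[[[x y] n] z] [Ax Ay ->]].
      by have [Ax Ay _] := Gfld _ _ _ _ Gz; split=> //; rewrite (Gf _ _ _ _ Gz).
    have [B [g [_ Bx By BG]]] := AG _ _ Ax Ay.
    by have gG := BG x y n Bx By; rewrite (Gf _ _ _ _ gG).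
have [|CA] := card_le_total A (~` A).
  move=> /(pairing_extend Kinf (conj fA finj))[B [g [Bg AB]]].
  by exfalso; apply: (Gmax (pairing_graph B g)); [rewrite GE|exists B, g].
have [h hA hinj] := card_le_fun (inhabits (c 0)) CA.
pose p x := if pselect (A x) then (x, false) else (h x, true).
have pA x : A (p x).1 by rewrite /p; case: pselect => //= /hA.
have pinj : injective p.
  move=> x y; rewrite /p; case: pselect => Ax; case: pselect => Ay //=.
    by case.
  by case=> /(hinj _ _ Ax Ay).
exists (fun t => f (p t.1.1).1 (p t.1.2).1
  (pickle ((p t.1.1).2, (p t.1.2).2, t.2))).
move=> [[x y] n] [[x' y'] n'] /= /finj[] // e1 e2 /(pcan_inj pickleK)[e3 e4 ->].
have -> : x = x'.
  by apply: pinj; rewrite [p x]surjective_pairing e1 e3 -surjective_pairing.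
have -> // : y = y'.
by apply: pinj; rewrite [p y]surjective_pairing e2 e4 -surjective_pairing.
Qed.

End Square.

(** * Sets of size at most the powerset of K *)

Section Small.
Variable K : choiceType.

Definition small (T : Type) := injects T (set K).

(** Surjections make smallness of sets monotone without a choice of a
    retraction. *)
Definition small_set (T : Type) (A : set T) :=
  exists e : set K -> T, A `<=` range e.

Hypothesis Kinf : injects nat K.

(** Letters used to code compound data as sets: three kinds of letters suffice
    for a tag, a subset of [K] and a binary relation on [K]. *)
Definition cell : Type := option K + K * K.

Lemma cell_injects : injects cell K.
Proof.
have [c _] := Kinf; apply: injects_trans (square_nat_injects Kinf).
exists (fun t : cell => match t with
  | inl None => (c 0, c 0, 0)
  | inl (Some k) => (k, k, 1)
  | inr (k, k') => (k, k', 2)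
  end).
by move=> [[k|]|[k k']] [[l|]|[l l']] //= [-> // ->].
Qed.

Lemma image_injective (T U : Type) (f : T -> U) : injective f ->
  injective (fun A : set T => f @` A).
Proof.
move=> fi A B AB; have H C : C = f @^-1` (f @` C).
  by apply/seteqP; split=> [x Cx|x [y Cy /fi <-]] //; exists x.
by rewrite (H A) AB -H.
Qed.

Lemma small_set_of (T : Type) : injects T K -> small (set T).
Proof.
by move=> [f fi]; exists (fun A => f @` A); exact: image_injective.
Qed.

Lemma small_cells (T : Type) : injects T (set cell) -> small T.
Proof.
by move=> Ti; apply: injects_trans Ti (small_set_of cell_injects).
Qed.

Lemma small_prod (T U : Type) : small T -> small U -> small (T * U).
Proof.
move=> [f fi] [g gi]; apply: small_cells.
exists (fun t c => match c with
  | inl None => False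
  | inl (Some k) => f t.1 k
  | inr (k, _) => g t.2 k
  end) => -[x y] [x' y'] /= E; congr pair.
  by apply/fi/funext => k; have := congr1 (@^~ (inl (Some k))) E.
by apply/gi/funext => k; have := congr1 (@^~ (inr (k, k))) E.
Qed.

Lemma small_sum (T U : Type) : small T -> small U -> small (T + U).
Proof.
move=> [f fi] [g gi]; apply: small_cells.
exists (fun t c => match c, t with
  | inl None, inl _ => True
  | inl None, inr _ => False
  | inl (Some k), inl x => f x k
  | inl (Some k), inr y => g y k
  | inr _, _ => False
  end) => -[x|y] [x'|y'] E.
- congr inl; apply/fi/funext => k.
  by have := congr1 (@^~ (inl (Some k))) E.
- by have /= H := congr1 (@^~ (inl None)) E; exfalso; rewrite -H.
- by have /= H := congr1 (@^~ (inl None)) E; exfalso; rewrite H.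
- congr inr; apply/gi/funext => k.
  by have := congr1 (@^~ (inl (Some k))) E.
Qed.

Lemma small_fun : small (K -> K).
Proof.
apply: small_cells; exists (fun h c => if c is inr (k, k') then h k = k' else False).
move=> h h' E; apply/funext => k.
by have /= H := congr1 (@^~ (inr (k, h' k))) E; rewrite H.
Qed.

Lemma small_range (T U : Type) (f : T -> U) : inhabited U -> small T ->
  small_set (range f).
Proof.
move=> [u0] [c ci].
exists (fun S => if pselect (exists t, c t = S) is left h
  then f (projT1 (cid h)) else u0).
move=> _ [t _ <-]; exists (c t) => //; case: pselect => [h|[]]; last by exists t.
by case: cid => t' /= /ci ->.
Qed.

(** Terms built from a constant by [K]-ary operations indexed by [I]; their
    values form the least set containing the constant and closed under the
    operations. *)
Inductive tree (I : Type) := Leaf | Node of I & K -> tree I.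

Fixpoint tree_eval (I T : Type) (op : I -> (K -> T) -> T) (x0 : T)
    (t : tree I) : T :=
  match t with
  | Leaf => x0
  | Node i f => op i (fun k => tree_eval op x0 (f k))
  end.

(** A node is coded by its label and by the disjoint union of the codes of its
    subtrees; the tag [inl None] separates nodes from the leaf. *)
Fixpoint tree_code (I : Type) (f : I -> set K) (c : set cell -> set K)
    (t : tree I) : set K :=
  match t with
  | Leaf => set0
  | Node i h => c (fun d => match d with
      | inl None => True
      | inl (Some k) => f i k
      | inr (k, k') => tree_code f c (h k) k'
      end)
  end.

Lemma small_tree (I : Type) : small I -> small (tree I).
Proof.
move=> [f fi]; have [d di] := cell_injects.
pose c (S : set cell) := d @` S.
have ci : injective c by exact: image_injective.
have c0 S : S (inl None) -> c S <> set0.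
  by move=> S0 /image_set0_set0 S00; rewrite S00 in S0.
exists (tree_code f c); elim=> [|i h IH] [|i' h'] //= E.
- by have [] := c0 _ Logic.I (esym E).
- by have [] := c0 _ Logic.I E.
move/ci: E => E; congr Node.
  apply/fi/funext => k; exact: (congr1 (@^~ (inl (Some k))) E).
apply/funext => k; apply: IH; apply/funext => k'.
exact: (congr1 (@^~ (inr (k, k'))) E).
Qed.

Lemma closing_off (I T : Type) (op : I -> (K -> T) -> T) (x0 : T) : small I ->
  exists A : set T, [/\ A x0, small_set A &
    forall i s, (forall k, A (s k)) -> A (op i s)].
Proof.
move=> /small_tree It; exists (range (tree_eval op x0)); split.
- by exists (Leaf I).
- exact: small_range (inhabits x0) It.
- move=> i s As; have /choice[f fs] : forall k, exists t, tree_eval op x0 t = s k.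
    by move=> k; have [t _ <-] := As k; exists t.
  exists (Node i f) => //=; congr op; exact/funext.
Qed.

End Small.

(** * Covers of H-closed spaces *)

Section OnePointExtension.
Variables (Y : topologicalType) (N : Y -> set Y).

(** [Y] with one more point, whose neighbourhoods are to contain the complement
    of the closure of some finite union of the [N y].  The closures of the [N y]
    then separate the new point from the points of [Y], and [Y] is closed in the
    extension only if one of these finite unions is dense. *)
Definition ideal_ext : Type := option Y.

HB.instance Definition _ := Choice.copy ideal_ext (option Y).

Definition into_ext : Y -> ideal_ext := Some.

Definition ideal_open : set (set ideal_ext) := [set O |
  open (into_ext @^-1` O) /\ (O None -> exists S : set Y,
    finite_set S /\ ~` closure (\bigcup_(y in S) N y) `<=` into_ext @^-1` O)].

Lemma ideal_openT : ideal_open setT.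
Proof. by split=> [|_]; [exact: openT|exists set0]. Qed.

Lemma ideal_openI : setI_closed ideal_open.
Proof.
move=> O P [oO fO] [oP fP]; split=> [|[/fO[S [Sf SO]] /fP[T [Tf TP]]]].
  exact: openI.
exists (S `|` T); split; first by rewrite finite_setU.
rewrite bigcup_setU closureU setCU.
by move=> y [/SO Oy /TP Py]; split.
Qed.

Lemma ideal_open_bigU (I : Type) (f : I -> set ideal_ext) :
  (forall i, ideal_open (f i)) -> ideal_open (\bigcup_i f i).
Proof.
move=> fo; split=> [|[i _ /(fo i).2[S [Sf Si]]]].
  by rewrite preimage_bigcup; apply: bigcup_open => i _; have [] := fo i.
by exists S; split=> // y /Si; exists i.
Qed.

HB.instance Definition _ := isOpenTopological.Build ideal_ext
  ideal_openT ideal_openI ideal_open_bigU.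

(** If no finite union of the [N y] were dense, [Y] would be a dense proper
    subspace of its Hausdorff extension [ideal_ext N]. *)
Lemma H_closed_finite_subcover : H_closed Y ->
  (forall y, open_nbhs y (N y)) ->
  exists S : set Y, finite_set S /\ closure (\bigcup_(y in S) N y) = setT.
Proof.
move=> [hY cY] No.
have oE (O : set ideal_ext) : open O = ideal_open O by [].
have SE (Q : set Y) : into_ext @^-1` (into_ext @` Q) = Q.
  by apply/seteqP; split=> [z [z' ? [<-]]|z]//; exists z.
have sep y : exists O P : set ideal_ext,
    [/\ O (into_ext y), P None, open O, open P & O `&` P = set0].
  exists (into_ext @` N y), (~` (into_ext @` closure (N y))); split.
  - by exists y => //; have [] := No y.
  - by case.
  - rewrite oE; split=> [|[]//]; rewrite SE; by have [] := No y.
  - have E : into_ext @^-1` (~` (into_ext @` closure (N y))) = ~` closure (N y).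
      exact: (congr1 setC (SE _)).
    rewrite oE; split=> [|_]; rewrite E.
      by apply: closed_openC; exact: closed_closure.
    by exists [set y]; split; [exact: finite_set1|rewrite bigcup_set1].
  - apply/seteqP; split=> // _ [[z Nz <-] []]; exists z => //.
    exact: subset_closure.
have hZ : hausdorff_space ideal_ext.
  rewrite open_hausdorff => -[x|] [y|] // xy.
  - have xy' : x != y by apply: contra_neq xy => ->.
    move: hY; rewrite open_hausdorff => /(_ _ _ xy')[[O P] /= [Ox Py] [oO oP OP]].
    exists (into_ext @` O, into_ext @` P) => /=.
      by split; apply/mem_set; [exists x|exists y] => //; exact/set_mem.
    split; try by rewrite oE; split=> [|[]//]; rewrite SE.
    apply/eqP/seteqP; split=> // _ [[z Oz <-] [z' Pz [zz]]].
    by move/eqP/seteqP: OP => [/(_ z) OP _]; apply: OP; rewrite -zz in Oz *; split.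
  - have [O [P [Ox Py oO oP /eqP OP]]] := sep x.
    by exists (O, P) => //=; split; exact/mem_set.
  - have [O [P [Ox Py oO oP OP]]] := sep y.
    by exists (P, O) => /=; [split; exact/mem_set|rewrite setIC OP].
have emb : embedding into_ext.
  split; first by move=> x y [].
  apply/seteqP; split=> [U oU|_ [V [oV _] <-]//].
  by exists (into_ext @` U : set ideal_ext) => //; rewrite oE; split=> [|[]//]; rewrite SE.
have /closed_openC := cY _ _ hZ emb.
rewrite oE => -[_ []]; first by case.
move=> S [Sf S0]; exists S; split=> //.
apply/seteqP; split=> // y _; apply: contrapT => /S0; apply; exists y => //.
Qed.

End OnePointExtension.

Lemma closure_bigcup_finite (X : topologicalType) (I : choiceType) (S : set I)
    (F : I -> set X) : finite_set S ->
  closure (\bigcup_(i in S) F i) `<=` \bigcup_(i in S) closure (F i).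
Proof.
move=> Sf; have cF : closed (\bigcup_(i in S) closure (F i)).
  by apply: closed_bigcup => // i _; exact: closed_closure.
rewrite [X in _ `<=` X](closure_id _).1 //; apply: closureS.
by move=> x [i Si Fi]; exists i => //; exact: subset_closure.
Qed.

Lemma H_closed_cover (X : topologicalType) (Y : set X) (N : X -> set X) :
  H_closed (set_type Y) -> (forall y, Y y -> open_nbhs y (N y)) ->
  exists S : set X, [/\ finite_set S, S `<=` Y &
    Y `<=` \bigcup_(y in S) closure (N y)].
Proof.
move=> HY No; pose M (y : set_type Y) : set (set_type Y) := val @^-1` N (val y).
have [y|S [Sf SM]] := @H_closed_finite_subcover _ M HY.
  have [oN Ny] := No _ (set_mem (valP y)).
  by split=> //; exists (N (val y)).
exists (val @` S); split.
- exact: finite_image.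
- by move=> _ [y _ <-]; exact/set_mem/valP.
move=> x Yx; have : closure (\bigcup_(y in S) M y) (SigSub (mem_set Yx)).
  by rewrite SM.
move=> /(closure_bigcup_finite Sf)[y Sy My]; exists (val y); first by exists y.
move=> U; rewrite nbhsE => -[V [oV Vx] VU].
have [|z [Mz Vz]] := My (val @^-1` V).
  by apply: open_nbhs_nbhs; split=> //; exists V.
by exists (val z); split=> //; exact: VU.
Qed.

(** * Theta-closed sets in Urysohn spaces *)

Lemma card_le_enum (K : Type) (T : choiceType) (A : set T) (B : set K) (a0 : T) :
  A #<= B -> A a0 ->
  exists s : K -> T, (forall i, A (s i)) /\ A `<=` range s.
Proof.
move=> AB Aa0; have [inhK|noK] := pselect (inhabited K); last first.
  have [f _ _] : exists2 f : A -> B, set_fun setT setT f & set_inj setT f.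
    exact/injfunPex/card_leP.
  by exfalso; apply: noK; split; exact: val (f (SigSub (mem_set Aa0))).
have [f _ finj] := card_le_fun inhK AB.
pose P k := [set x | A x /\ f x = k].
exists (fun k => xget a0 (P k)); split=> [k|x Ax].
  by case: xgetP => [x _ []|].
exists (f x) => //; have /xgetPex-/(_ a0)[Ay] : exists y, P (f x) y by exists x.
exact: finj.
Qed.

Definition theta_closed (X : topologicalType) (A : set X) := forall p,
  (forall U, open_nbhs p U -> closure U `&` A !=set0) -> A p.

Lemma theta_closedPn (X : topologicalType) (A : set X) p : theta_closed A ->
  ~ A p -> exists2 U, open_nbhs p U & closure U `&` A = set0.
Proof.
move=> tA; apply: contra_notP => nU; apply: tA => U pU.
by apply/set0P/eqP => UA; apply: nU; exists U.
Qed.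

Lemma theta_closed_closed (X : topologicalType) (A : set X) :
  theta_closed A -> closed A.
Proof.
move=> tA p clAp; apply: tA => U pU.
have [x [Ax Ux]] := clAp U (open_nbhs_nbhs pU).
by exists x; split=> //; exact: subset_closure.
Qed.

Section Bound.
Variables (X : topologicalType) (K : choiceType) (V : X -> K -> set X).
Hypotheses (Kinf : injects nat K) (uX : Urysohn_space X).
Hypothesis Vnbhs : forall x i, open_nbhs x (V x i).
Hypothesis Vbase : forall x U, open_nbhs x U ->
  exists i, closure (V x i) `<=` closure U.

Lemma closure_sep x y : x <> y -> exists i, ~ closure (V x i) y.
Proof.
move=> /uX[U [W [xU yW UW]]]; have [i iU] := Vbase xU; exists i => /iU Uy.
have : (closure U `&` closure W) y by split=> //; apply: subset_closure; case: yW.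
by rewrite UW.
Qed.

(** If [p] and [q] had neighbourhoods [U] and [W] with disjoint closures, take
    [V p i] for [U] and [V q j] for [W], and [V q k] for [V q i `&` V q j]: the
    point [s k] is in the closure of [V q i], hence in that of [V p i], and in
    that of [V q j], so in both closures. *)
Lemma theta_trace_inj (s : K -> X) p q :
  (forall i, closure (V p i) (s i)) -> (forall i, closure (V q i) (s i)) ->
  (forall i j, closure (V p i) (s j) <-> closure (V q i) (s j)) -> p = q.
Proof.
move=> ps qs pq; apply: contrapT => /uX[U [W [pU qW UW]]].
have [i iU] := Vbase pU; have [j jW] := Vbase qW.
have : open_nbhs q (V q i `&` V q j) by exact: open_nbhsI.
move=> /Vbase[k kV].
have [qi qj] := closureI (kV _ (qs k)).
have : (closure U `&` closure W) (s k) by split; [apply/iU/pq|exact: jW].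
by rewrite UW.
Qed.

(** Theta-closure is added to the given operations by letting each relation on
    [K] act on a sequence as the decoding of the trace of a point along that
    sequence. *)
Lemma theta_closing_off (I : Type) (op : I -> (K -> X) -> X) (x0 : X) :
  small K I -> exists A : set X, [/\ A x0, small_set K A, theta_closed A &
    forall i s, (forall k, A (s k)) -> A (op i s)].
Proof.
move=> sI; have sKK : small K (set (K * K)).
  apply: small_set_of; apply: injects_trans (cell_injects Kinf).
  by exists inr => ? ? [].
pose Q (L : set (K * K)) s := [set p | (forall i, closure (V p i) (s i)) /\
  forall i j, L (i, j) <-> closure (V p i) (s j)].
pose op' u s := match u with inl L => xget x0 (Q L s) | inr i => op i s end.
have [A [Ax0 sA Aop]] := closing_off Kinf op' x0 (small_sum Kinf sKK sI).
exists A; split=> // [p pA|i s]; last exact: (Aop (inr i)).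
have /choice[s sP] : forall i, exists x, closure (V p i) x /\ A x.
  by move=> i; have [x] := pA _ (Vnbhs p i); exists x.
pose L := [set u : K * K | closure (V p u.1) (s u.2)].
have [qs Lq] : Q L s (xget x0 (Q L s)).
  by apply: xgetPex; exists p; split=> [i|//]; have [] := sP i.
rewrite (@theta_trace_inj s p (xget x0 (Q L s))) //.
  by apply: (Aop (inl L)) => i; have [] := sP i.
by move=> i; have [] := sP i.
Qed.

(** The hypothesis weakens the covering property of H-closed subspaces from
    finite subfamilies to subfamilies indexed by [K], which is all that the
    closing-off argument needs. *)
Lemma theta_small (Y : set X) : Y !=set0 ->
  (forall N, (forall y, Y y -> open_nbhs y (N y)) ->
    exists s : K -> X, (forall i, Y (s i)) /\
      Y `<=` \bigcup_i closure (N (s i))) ->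
  small_set K Y.
Proof.
move=> [x0 Yx0] Ycov.
pose miss (s : K -> X) (t : K -> K) := Y `\` \bigcup_i closure (V (s i) (t i)).
have [A [Ax0 [e Ae] tA Aop]] := @theta_closing_off (K -> K)
  (fun t s => xget x0 (miss s t)) x0 (small_fun Kinf).
exists e; apply: subset_trans Ae => q Yq; apply: contrapT => nAq.
have /choice[N NP] x : exists N, open_nbhs x N /\
    if pselect (A x) then exists2 i, N = V x i & ~ closure N q
    else closure N `&` A = set0.
  case: pselect => Ax; last by have [U] := theta_closedPn tA Ax; exists U.
  have [|i nq] := @closure_sep x q; first by move=> xq; rewrite xq in Ax.
  by exists (V x i); split=> //; exists i.
have [y _|s [Ys scov]] := Ycov N; first by have [] := NP y.
(* indices outside [A] are redirected to [x0], whose neighbourhood also has a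
   closure missing [q] *)
pose s' i := if pselect (A (s i)) then s i else x0.
have As' i : A (s' i) by rewrite /s'; case: pselect.
have /choice[t tP] i : exists j, N (s' i) = V (s' i) j /\ ~ closure (N (s' i)) q.
  have [_] := NP (s' i); case: pselect => [_ [j]|/(_ (As' i))//].
  by exists j.
set z := xget x0 (miss s' t).
have [Yz nz] : miss s' t z.
  apply: xgetPex; exists q; split=> // -[i _].
  by have [<-] := tP i.
have Az : A z by exact: Aop.
have [i _ zi] := scov _ Yz; have [_] := NP (s i).
case: pselect => /= [Asi _|_ NA].
  apply: nz; exists i => //; have [<- _] := tP i.
  by rewrite /s'; case: pselect.
by have : (closure (N (s i)) `&` A) z by []; rewrite NA.
Qed.

Lemma H_closed_small (Y : set X) : Y !=set0 -> H_closed (set_type Y) ->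
  small_set K Y.
Proof.
move=> /[dup] -[y0 Yy0] Y0 HY; apply: theta_small => // N /(H_closed_cover HY).
move=> [S [Sf SY YS]].
have [x0 Sx0 _] := YS _ Yy0.
have SK : S #<= [set: K].
  have [//|KS] := card_le_total S [set: K].
  have /finite_setPn[] : finite_set [set: K] by exact: card_le_finite KS Sf.
  have [c ci] := Kinf.
  pose f (n : [set: nat]) : [set: K] := SigSub (in_setT (c (val n))).
  by apply: (@card_le_inj _ _ _ _ f) => m n [] /ci/val_inj.
have [s [Ss sS]] := card_le_enum SK Sx0.
exists s; split=> [i|y /YS[z /sS[i _ <-] zy]]; first exact: SY.
by exists i.
Qed.

(** Separate [a] from each point of [Y] by closures; finitely many of these
    closures cover [Y], and the intersection of the corresponding
    neighbourhoods of [a] has a closure missing all of them. *)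
Lemma H_closed_sep (Y : set X) a : H_closed (set_type Y) -> ~ Y a ->
  exists i, closure (V a i) `&` Y = set0.
Proof.
move=> HY nYa.
have /choice[N NP] y : exists N, Y y -> open_nbhs y N /\
    exists2 P, open_nbhs a P & closure P `&` closure N = set0.
  have [ay|/uX[P [N [aP yN PN]]]] := pselect (a = y).
    by exists set0; rewrite -ay.
  by exists N => _; split=> //; exists P.
have [y /(NP y)[]//|S [Sf SY YS]] := @H_closed_cover _ _ N HY.
have /choice[P PP] y : exists P, open_nbhs a P /\
    (S y -> closure P `&` closure (N y) = set0).
  have [Sy|nSy] := pselect (S y); last by exists setT; split=> //; split=> //; exact: openT.
  by have [_ [P aP PN]] := NP _ (SY _ Sy); exists P.
have aP : open_nbhs a (\bigcap_(y in S) P y).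
  split; last by move=> y _; have [[]] := PP y.
  rewrite -[X in open X]setCK; apply: closed_openC; rewrite setC_bigcap.
  by apply: closed_bigcup => // y _; apply: open_closedC; have [[]] := PP y.
have [i iP] := Vbase aP; exists i; apply/seteqP; split=> // z [/iP Pz /YS[y Sy Nz]].
have [_ /(_ Sy) PN] := PP y; rewrite -PN; split=> //.
by move: Pz; apply: closureS => w /(_ y Sy).
Qed.

(** The second closing-off argument: [A] absorbs members of the pi-base missing
    unions of [K] many basic neighbourhoods of its points, and the weak Lindelof
    property contradicts the existence of a point outside. *)
Lemma small_space (B : set (set X)) : H_closed_pi_base B ->
  wL_le X [set: K] ->
  inhabited X -> small_set K [set: X].
Proof.
move=> [[Bo Bpi] HB] wLK [x0].
have /choice[e eP] (b : set X) : exists e : set K -> X, B b -> closure b `<=` range e.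
  have [Bb|nBb] := pselect (B b); last by exists (fun=> x0).
  have [|e eb] := H_closed_small _ (HB b Bb); last by exists e.
  by have [_ [x bx]] := Bo _ Bb; exists x; exact: subset_closure.
(* [e b] enumerates the closure of [b]; the second component of the index [u]
   below runs through that enumeration *)
pose trace (s : K -> X) (t : K -> K) := \bigcup_i V (s i) (t i).
pose miss s t := [set b | B b /\ b `&` trace s t = set0].
have sI : small K ((K -> K) * set K).
  by apply: small_prod => //; [exact: small_fun|exists id].
have [A [Ax0 [f Af] tA Aop]] := theta_closing_off
  (fun (u : (K -> K) * set K) s => e (xget set0 (miss s u.1)) u.2) x0 sI.
exists f; apply: subset_trans Af => q _; apply: contrapT => nAq.
have [U [oU Uq] UA] := theta_closedPn tA nAq.
have [|b0 Bb0 b0U] := Bpi U oU; first by exists q.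
have /choice[t tP] a : exists i, A a -> V a i `&` b0 = set0.
  have [Aa|nAa] := pselect (A a); last first.
    by have [c _] := Kinf; exists (c 0).
  have [|i iV] := @H_closed_sep _ a (HB _ Bb0).
    move=> /(closureS b0U) Ua.
    by have : (closure U `&` A) a by []; rewrite UA.
  exists i => _; apply/seteqP; split=> // x [Vx b0x]; rewrite -iV.
  by split; exact: subset_closure.
pose C := [set V a (t a) | a in A] `|` [set ~` A].
have [|D [DC DK Dd]] := wLK C.
  split=> [W [[a Aa <-]|->]|]; first by have [] := Vnbhs a (t a).
    by apply: closed_openC; exact: theta_closed_closed.
  apply/seteqP; split=> // x _; have [Ax|nAx] := pselect (A x).
    by exists (V x (t x)); [left; exists x|have [] := Vnbhs x (t x)].
  by exists (~` A) => //; right.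
have meets b : B b -> exists2 d, D d & b `&` d !=set0.
  move=> /Bo[ob [x bx]].
  have : closure (\bigcup_(U in D) U) x by rewrite Dd.
  move=> /(_ b (open_nbhs_nbhs (conj ob bx)))[y [[d ? dy] yb]].
  by exists d => //; exists y.
have [d0 Dd0 _] := meets _ Bb0.
have [u [uD Du]] := card_le_enum DK Dd0.
have /choice[s sP] k : exists a, A a /\ (u k = ~` A \/ u k = V a (t a)).
  have [[a Aa <-]|->] := DC _ (uD k).
    by exists a; split=> //; right.
  by exists x0; split=> //; left.
have As k : A (s k) by have [] := sP k.
have [Bb btr] : miss s (t \o s) (xget set0 (miss s (t \o s))).
  apply: xgetPex; exists b0; split=> //; apply/seteqP; split=> // x [bx [k _ Vx]].
  by rewrite -(tP _ (As k)).
set b := xget _ _ in Bb btr.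
have bA : b `<=` A.
  move=> x /subset_closure /(eP _ Bb)[L _ <-].
  exact: (Aop (t \o s, L) s As).
have [d /Du[k _ <-] [x [bx ux]]] := meets _ Bb.
have [_ [E|E]] := sP k; rewrite E in ux; first by apply: ux; exact: bA.
have : (b `&` trace s (t \o s)) x by split=> //; exists k.
by rewrite btr.
Qed.

End Bound.

(** * The cardinal inequality *)

(** By the Urysohn property the intersection of a family witnessing [k] at [x]
    is the singleton of [x]; for a finite family it is open. *)
Lemma finite_k_discrete (X : topologicalType) (T : Type) (K : set T) :
  Urysohn_space X -> k_le X K -> finite_set K -> forall x : X, open [set x].
Proof.
move=> uX kK Kf x; have [V [Vx VK Vb]] := kK x.
have Vf : finite_set V by exact: card_le_finite VK Kf.
have -> : [set x] = \bigcap_(W in V) W.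
  apply/seteqP; split=> [_ -> W /Vx[]//|y Vy].
  apply: contrapT => yx; have [|U [W [xU yW UW]]] := uX x y.
    by move=> xy; apply: yx.
  have [P VP PU] := Vb U xU.
  have : (closure U `&` closure W) y.
    split; last by apply: subset_closure; case: yW.
    by apply: PU; apply: subset_closure; exact: Vy.
  by rewrite UW.
rewrite -[X in open X]setCK setC_bigcap; apply: closed_openC.
by apply: closed_bigcup => // W /Vx[oW _]; exact: open_closedC.
Qed.

Lemma discrete_wL (X : topologicalType) (T : Type) (K : set T) :
  (forall x : X, open [set x]) -> wL_le X K -> [set: X] #<= K.
Proof.
move=> oX /(_ [set [set x] | x in setT])[|D [DC DK Dd]].
  split=> [_ [x _ <-]//|]; apply/seteqP; split=> // x _.
  by exists [set x] => //; exists x.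
apply: card_le_trans DK.
have Dx (x : X) : [set x] \in D.
  have : closure (\bigcup_(U in D) U) x by rewrite Dd.
  move=> /(_ [set x] (open_nbhs_nbhs (conj (oX x) erefl))).
  move=> [y [[U DU Uy] yx]]; rewrite yx in Uy.
  by have [z _ zU] := DC _ DU; apply/mem_set; move: DU Uy; rewrite -zU => + ->.
pose f (x : [set: X]) : D := SigSub (Dx (val x)).
apply: (@card_le_inj _ _ _ _ f) => x y [] E; apply/val_inj.
by have : [set val x] (val x) by []; rewrite E.
Qed.

Lemma small_card_le (T : Type) (U : choiceType) (P : set U) :
  small_set (set_type P) [set: T] -> [set: T] #<= [set A : set U | A `<=` P].
Proof.
move=> [e eT]; have /choice[g gP] x : exists S, e S = x.
  by have [S _ <-] := eT x Logic.I; exists S.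
have vP (S : set P) : val @` S \in [set A : set U | A `<=` P].
  by apply/mem_set => _ [y _ <-]; exact/set_mem/valP.
pose f (x : [set: T]) : [set A : set U | A `<=` P] :=
  SigSub (vP (g (val x))).
apply: (@card_le_inj _ _ _ _ f) => x y [] /(image_injective val_inj) E.
by apply/val_inj; rewrite -(gP (val x)) E gP.
Qed.

Lemma card_le_set_type (T U : Type) (A : set T) (P : set U) (h : T -> U) :
  injective h -> (forall x, A x -> P (h x)) -> A #<= [set: set_type P].
Proof.
move=> hi hP; have hA (x : A) : h (val x) \in P.
  exact/mem_set/hP/set_mem/valP.
pose f (x : A) : [set: set_type P] := SigSub (in_setT (SigSub (hA x) : P)).
by apply: (@card_le_inj _ _ _ _ f) => x y [] /hi/val_inj.
Qed.

Lemma card_le_nonempty (T U : Type) (A : set T) (B : set U) :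
  A #<= B -> A !=set0 -> B !=set0.
Proof.
move=> /card_leP/injfunPex[f _ _] [x Ax].
by exists (val (f (SigSub (mem_set Ax)))); exact/set_mem/valP.
Qed.

Theorem theorem3p12 (X : topologicalType) (hX : hausdorff_space X)
    (uX : Urysohn_space X) (piX : exists B : set (set X), H_closed_pi_base B) :
  [set: X] #<= [set A : set (set X * set X) | A `<=` wL X `*` k X].
Proof.
have [[x0]|X0] := pselect (inhabited X); last first.
  rewrite (_ : [set: X] = set0); first exact: card_ge0.
  by apply/seteqP; split=> // x _; apply: X0; split.
have wLX := @wLP X; have kX := @kP X.
have [k0 kk0] : k X !=set0.
  have [W [_ Wk Wb]] := kX x0; apply: card_le_nonempty Wk _.
  by have [|P WP _] := Wb setT; [split=> //; exact: openT|exists P].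
have [w0 ww0] : wL X !=set0.
  have [|D [_ DwL Dd]] := wLX [set setT].
    by split=> [_ ->|]; [exact: openT|rewrite bigcup_set1].
  have : closure (\bigcup_(U in D) U) x0 by rewrite Dd.
  move=> /(_ setT filterT)[y [[U DU _] _]].
  by apply: card_le_nonempty DwL _; exists U.
pose P := wL X `*` k X; pose K : choiceType := set_type P.
have K0 : K := SigSub (mem_set (conj ww0 kk0 : P (w0, k0))).
have wK : wL X #<= [set: K].
  by apply: (@card_le_set_type _ _ _ _ (pair^~ k0)) => [x y []|].
have kK : k X #<= [set: K].
  by apply: (@card_le_set_type _ _ _ _ (pair w0)) => [x y []|].
apply: small_card_le.
have [kf|kinf] := pselect (finite_set (k X)).
  have XK := card_le_trans (discrete_wL (finite_k_discrete uX kX kf) wLX) wK.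
  have [s [_ sX]] := @card_le_enum K X setT setT x0 XK Logic.I.
  exists (fun S => if pselect (exists i, S = [set i]) is left h
    then s (projT1 (cid h)) else x0).
  move=> x /sX[i _ <-]; exists [set i] => //; case: pselect => [h|[]]; last by exists i.
  by case: cid => j /= E; congr s; have : [set i] i by []; rewrite E => ->.
have Kinf : injects nat K.
  have /infiniteP/card_le_trans/(_ kK) := kinf.
  move=> /(card_le_fun (inhabits K0))[f _ fi].
  by exists f => m n /fi; apply.
have /choice[V VP] (x : X) : exists V : K -> set X, (forall i, open_nbhs x (V i)) /\
    forall U, open_nbhs x U -> exists i, closure (V i) `<=` closure U.
  have [W [Wx Wk Wb]] := kX x.
  have [|P0 WP0 _] := Wb setT; first by split=> //; exact: openT.
  have [s [sW Ws]] := card_le_enum (card_le_trans Wk kK) WP0.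
  exists s; split=> [i|U /Wb[Q /Ws[i _ <-] QU]]; first exact/Wx.
  by exists i.
have [B HB] := piX.
apply: (@small_space X K V Kinf uX _ _ B HB) => //.
- by move=> x i; have [] := VP x.
- by move=> x; have [] := VP x.
- move=> C /wLX[D [DC Dw Dd]]; exists D; split=> //; exact: card_le_trans Dw wK.
Qed.
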